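(* Let $\sigma>0$, $\alpha\ge2$ and $\beta\in(0,\tfrac12)$. Let $(\Delta_n)_{n\ge1}$ be positive reals and $(\mu_n)_{n\ge1}$ measurable estimators $\mu_n:\mathbb R^n\to\mathbb R$ with $\beta_n(\mu_n;\Delta_n)\le\beta$ for all $n$. Then $$\liminf_{n\to\infty}\frac{\sqrt n\,\Delta_n}{\sigma}\;\ge\;\Phi^{-1}(1-\beta),$$ where $\Phi$ is the standard normal distribution function.
   Context: For $\mu\in\mathbb R$, $\mathcal C_\mu$ is the set of Borel probability measures $P$ on $\mathbb R$ with $\int x\,dP=\mu$ and $\int|x-\mu|^\alpha\,dP\le\sigma^\alpha$. The worst-case confidence level of an estimator $\mu_n=\mu_n(X_1,\dots,X_n)$ at margin $\Delta>0$ is $$\beta_n(\mu_n;\Delta)=\max\Bigl\{\sup_{\mu\in\mathbb R,\,P_\mu\in\mathcal C_\mu}P_\mu[\mu_n>\mu+\Delta],\ \sup_{\mu\in\mathbb R,\,P_\mu\in\mathcal C_\mu}P_\mu[\mu_n<\mu-\Delta]\Bigr\},$$ where under $P_\mu$ the observations $X_1,\dots,X_n$ are i.i.d. with law $P_\mu$. *)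

(* Defs.v *)
From HB Require Import structures.
From mathcomp Require Import all_boot all_order all_algebra.
From mathcomp Require Import all_classical all_reals all_analysis.

Set Implicit Arguments.
Unset Strict Implicit.
Unset Printing Implicit Defensive.
Import Order.TTheory GRing.Theory Num.Theory.
Import numFieldNormedType.Exports.
Local Open Scope classical_set_scope.
Local Open Scope ring_scope.

Section product_law.
Context d (T : measurableType d) (R : realType).

Definition tcons n (x : T * n.-tuple T) : n.+1.-tuple T := [tuple of x.1 :: x.2].

Lemma measurable_tcons n : measurable_fun [set: T * n.-tuple T] (@tcons n).
Proof. exact: measurable_cons. Qed.

HB.instance Definition _ n :=
  isMeasurableFun.Build _ _ _ _ (@tcons n) (@measurable_tcons n).

(* The joint law of n i.i.d. observations with law P, i.e. the n-fold product
   of P, with R^n encoded as n.-tuple R. *)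
Fixpoint iid_law (P : probability T R) (n : nat) : probability (n.-tuple T) R :=
  if n is n'.+1 then distribution (P \x iid_law P n')%E (@tcons n')
  else \d_([tuple] : 0.-tuple T).

End product_law.

Section worst_case.
Context {R : realType}.
Local Open Scope ereal_scope.

(* The first condition entails integrability: the integral of a measurable
   function that is not integrable is +oo or -oo. *)
Definition mean_moment_class (sigma alpha mu : R) : set (probability R R) :=
  [set P : probability R R | \int[P]_x x%:E = mu%:E /\
     \int[P]_x (`|x - mu| `^ alpha)%:E <= (sigma `^ alpha)%:E].

Definition worst_case_level (sigma alpha : R) (n : nat)
    (est : n.-tuple R -> R) (Delta : R) : \bar R :=
  maxe
    (ereal_sup [set p | exists mu : R,
       exists2 P : probability R R, mean_moment_class sigma alpha mu P &
         p = iid_law P n [set x | (est x > mu + Delta)%R]])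
    (ereal_sup [set p | exists mu : R,
       exists2 P : probability R R, mean_moment_class sigma alpha mu P &
         p = iid_law P n [set x | (est x < mu - Delta)%R]]).

End worst_case.

Definition Phi {R : realType} (x : R) : R := fine (normal_prob 0 1 `]-oo, x]).

(* [pinv] picks a preimage when there is one. Phi is a strictly increasing
   bijection from R onto ]0, 1[, so this is its inverse function there; the
   constant 0 is only a default value outside ]0, 1[. *)
Definition Phi_inv {R : realType} : R -> R := 'pinv_(fun=> 0) [set: R] Phi.

(* Main.v *)
(* The proof is a two-point testing argument with two-point laws. For small d,
   the laws P_p on {-a, a} with a = sigma - d and p = (1 +- d / a) / 2 have mean
   +- d and satisfy |X - mean| <= sigma almost surely, so they belong to the
   class whatever alpha is. If d > Delta, the event est > 0 tests one against
   the other with both errors at most beta, and by Neyman-Pearson the best such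
   test is the majority vote: beta is at least the binomial tail
   F(p) = P[Bin(2m+1, p) <= m], with 2m+1 in {n, n+1}.
   The derivative of F is an explicit multiple of - (p (1 - p))^m, which is
   compared with the Gaussian density through 1 - y <= exp (- y) and, for small
   y, 1 - y >= exp (- (1 + e) y). Using the first inequality up to p and the
   second one up to a fixed point eliminates the normalizing constant, so no
   central limit theorem and no Stirling formula are needed. *)

Require Import Defs.
From HB Require Import structures.
From mathcomp Require Import all_boot all_order all_algebra.
From mathcomp Require Import all_classical all_reals all_analysis.
From mathcomp Require Import measurable_realfun ring lra zify.

Set Implicit Arguments.
Unset Strict Implicit.
Unset Printing Implicit Defensive.
Import Order.TTheory GRing.Theory Num.Theory.
Import numFieldNormedType.Exports.
Local Open Scope classical_set_scope.
Local Open Scope ring_scope.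

(** * Monotonicity and the standard normal distribution function *)

Lemma ger0_is_derive_le (R : realType) (f df : R -> R) (a b : R) :
  (forall x : R, is_derive x 1 f (df x)) -> a <= b ->
  (forall x, a < x < b -> 0 <= df x) -> f a <= f b.
Proof.
move=> fdf ab df0.
have cf : continuous f.
  move=> x; apply/differentiable_continuous/derivable1_diffP.
  exact: ex_derive.
apply: (@ger0_derive1_le_cc _ f a b) => //.
- by move=> x; rewrite in_itv/= derive1E => xab; rewrite derive_val; exact: df0.
- exact: continuous_subspaceT.
- by rewrite in_itv/= lexx.
- by rewrite in_itv/= lexx ab.
Qed.

Section standard_normal.
Context {R : realType}.
Implicit Types x y : R.

Lemma normal_pdf01E x :
  normal_pdf 0 1 x = (Num.sqrt (pi *+ 2))^-1 * expR (- (x ^+ 2 / 2)).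
Proof.
rewrite normal_pdfE ?oner_neq0// /normal_peak /normal_fun.
by rewrite expr1n mul1r subr0 mulNr.
Qed.

#[global] Instance is_derive_Phi x : is_derive x 1 (@Phi R) (normal_pdf 0 1 x).
Proof.
have [||||dPhi Phi'] := @continuous_FTC1 R (normal_pdf 0 1) -oo%O x (x + 1).
- by rewrite ltrDl.
- apply: (@integrableS _ _ _ _ setT) => //=.
  exact: (@integrable_normal_pdf R 0 1).
- by rewrite ltNyr.
- exact/continuous_normal_pdf/oner_neq0.
by apply: DeriveDef; [exact: dPhi | rewrite -derive1E; exact: Phi'].
Qed.

Lemma continuous_Phi : continuous (@Phi R).
Proof.
by move=> x; apply/differentiable_continuous/derivable1_diffP; exact: ex_derive.
Qed.

Lemma Phi_incr x y : x < y -> Phi x < Phi y.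
Proof.
move=> xy; apply: (@gtr0_derive1_lt_cc _ (@Phi R) x y) => //.
- move=> t _; rewrite derive1E derive_val normal_pdf01E mulr_gt0 ?expR_gt0//.
  by rewrite invr_gt0 sqrtr_gt0 mulrn_wgt0// pi_gt0.
- by apply: continuous_subspaceT; exact: continuous_Phi.
- by rewrite in_itv/= lexx ltW.
- by rewrite in_itv/= lexx ltW.
Qed.

Lemma Phi_ndecr x y : x <= y -> Phi x <= Phi y.
Proof. by rewrite le_eqVlt => /predU1P[->//|/Phi_incr/ltW]. Qed.

(** As a random variable under the normal law, the identity has [Phi] as its distribution function,
    so the general limits of a [cdf] at infinity apply to [Phi]. *)
Let idR : measurableTypeR R -> R := idfun.

#[local] HB.instance Definition _ :=
  @isMeasurableFun.Build _ _ _ _ idR (@measurable_id _ _ setT).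

Let cdf_normal :
  cdf (idR : {RV (normal_prob (0 : R) 1 : probability _ R) >-> R}) = EFin \o Phi.
Proof.
apply/funext => x; rewrite /cdf /distribution /pushforward/= /Phi fineK//.
by rewrite fin_num_measure.
Qed.

Lemma cvg_Phiy : Phi x @[x --> +oo] --> (1 : R).
Proof.
apply: (@fine_cvg _ _ _ _ (EFin \o Phi)).
by rewrite -cdf_normal; exact: cvg_cdfy1.
Qed.

Lemma cvg_PhiNy : Phi x @[x --> -oo] --> (0 : R).
Proof.
apply: (@fine_cvg _ _ _ _ (EFin \o Phi)).
by rewrite -cdf_normal; exact: cvg_cdfNy0.
Qed.

Lemma Phi0 : Phi 0 = 2^-1 :> R.
Proof.
(* The density is even, so this sum has derivative 0. Its limit at +oo is 1 + 0, whence
   [2 * Phi 0 = 1]. *)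
have PhiN x : Phi x + Phi (- x) = 2 * Phi (0 : R).
  rewrite -[RHS](_ : Phi 0 + Phi (- 0) = _); last by rewrite oppr0 mulr_natl.
  apply: (@is_derive_0_is_cst _ (fun x => Phi x + Phi (- x))) => t.
  apply: is_derive_eq; rewrite !normal_pdf01E sqrrN.
  by rewrite mulrN1 subrr.
apply/(mulfI (_ : 2 != 0)) => //; rewrite divff//.
have c2 : (fun x => Phi x + Phi (- x)) x @[x --> +oo] --> (2 * Phi (0 : R)).
  by under eq_fun do rewrite PhiN; exact: cvg_cst.
have PhiN0 : Phi (- x) @[x --> +oo] --> (0 : R).
  exact/(cvgNy_compNP Phi)/cvg_PhiNy.
rewrite -(cvg_lim (@Rhausdorff R) c2); apply: (cvg_lim (@Rhausdorff R)).
by have := cvgD cvg_Phiy PhiN0; rewrite addr0; exact.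
Qed.

Lemma Phi_invK (b : R) : 0 < b < 1 -> Phi (Phi_inv b) = b.
Proof.
move=> /andP[b0 b1]; apply: pinvK; rewrite inE/=.
(* [pinvK] asks for a preimage of [b]: the limits 0 and 1 provide points on either side of it, and
   the intermediate value theorem applies between them. *)
near (-oo%R : set_system R) => x.
near (+oo%R : set_system R) => y.
have xb : Phi x < b by near: x; exact: (cvgr_lt 0 cvg_PhiNy).
have yb : b < Phi y by near: y; exact: (cvgr_gt 1 cvg_Phiy).
have xy : x <= y.
  rewrite leNgt; apply/negP => /Phi_incr.
  by rewrite ltNge (ltW (lt_trans xb yb)).
have [||c _ <-] := @IVT _ Phi x y b xy.
- by apply: continuous_subspaceT; exact: continuous_Phi.
- by rewrite ge_min le_max (ltW xb) (ltW yb) orbT.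
by exists c.
Unshelve. all: by end_near. Qed.

End standard_normal.

(** * Binomial tails as functions of the success probability *)

Definition binomial_cdf (R : realType) (n m : nat) (p : R) : R :=
  \sum_(k < m.+1) p ^+ k * (1 - p) ^+ (n - k) *+ 'C(n, k).

Section binomial_cdf.
Context {R : realType}.
Implicit Types (n m k : nat) (p w : R).

Lemma is_derive_exprn (f : R -> R) (x df : R) n : is_derive x 1 f df ->
  is_derive x 1 (fun y => f y ^+ n) (n%:R * f x ^+ n.-1 * df).
Proof.
move=> fdf; elim: n => [|[|n] IHn].
- by rewrite !mul0r; exact: is_derive_cst.
- by rewrite !mul1r; exact: fdf.
- rewrite (_ : (fun y => _) = (fun y => f y * f y ^+ n.+1)); last first.
    by apply/funext => y; rewrite exprS.
  apply: is_derive_eq; rewrite /GRing.scale/= -[n.+2%:R]natr1 exprS.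
  ring.
Qed.

(** The derivatives of the terms telescope: the derivative of the term of index [m.+1] is a
    difference whose first half cancels the sum so far, and [mul_bin_left] rewrites the other half
    in the same form. *)
Lemma is_derive_binomial_cdf n m p : (m < n)%N ->
  is_derive p 1 (@binomial_cdf R n m)
    (- (m.+1 * 'C(n, m.+1))%:R * (p ^+ m * (1 - p) ^+ (n - m.+1))).
Proof.
have dX k : is_derive p 1 (fun y => y ^+ k) (k%:R * p ^+ k.-1 * 1).
  exact: (@is_derive_exprn id).
have dY k : is_derive p 1 (fun y => (1 - y) ^+ k)
    (k%:R * (1 - p) ^+ k.-1 * (0 - 1)).
  exact: (@is_derive_exprn (fun y => 1 - y)).
elim: m => [|m IHm] mn.
  rewrite (_ : binomial_cdf _ _ = fun x => (1 - x) ^+ n).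
    apply: is_derive_eq.
    by rewrite mul1n bin1 subn1 expr0; ring.
  by apply/funext => x; rewrite /binomial_cdf big_ord1 expr0 mul1r subn0 bin0.
have /IHm dF : (m < n)%N by exact: ltnW.
rewrite (_ : binomial_cdf _ _ = fun x => binomial_cdf n m x +
    ('C(n, m.+1))%:R * (x ^+ m.+1 * (1 - x) ^+ (n - m.+1))); last first.
  by apply/funext => x; rewrite /binomial_cdf big_ord_recr/= mulr_natl.
apply: is_derive_eq.
rewrite /GRing.scale/= (mul_bin_left n m.+1) (subnS n m.+1).
(* [j] is positive because [m.+1 < n]; writing it as a successor removes the predecessor in the
   exponent. *)
set j := (n - m.+1)%N; have [i ->] : exists i, j = i.+1.
  by exists j.-1; rewrite prednK// subn_gt0.
rewrite /= !exprS !natrM.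
ring.
Qed.

(** Expand [((1 - p) + p) ^+ m.*2.+1]: the reflection of the index maps the upper half of the terms
    onto the lower half with [p] and [1 - p] exchanged. *)
Lemma binomial_cdf_symm m p :
  binomial_cdf m.*2.+1 m p + binomial_cdf m.*2.+1 m (1 - p) = 1.
Proof.
rewrite /binomial_cdf.
have := exprDn (1 - p) p m.*2.+1; rewrite subrK expr1n.
rewrite -addnn -addnS -!addSn => e; rewrite [RHS]e.
rewrite big_split_ord/=; congr (_ + _).
  by apply: eq_bigr => i _; rewrite mulrC.
rewrite (reindex_inj rev_ord_inj)/=; apply: eq_bigr => i _.
have im := ltn_ord i.
rewrite subKr subSS (_ : (m + m.+1 - (m.+1 + i) = m - i)%N); last by lia.
rewrite (_ : (m + m.+1 - (m - i) = m.+1 + i)%N); last by lia.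
rewrite -[in RHS]bin_sub; last by lia.
by rewrite (_ : (m + m.+1 - (m.+1 + i) = m - i)%N); last by lia.
Qed.

Lemma binomial_cdf_half m : binomial_cdf m.*2.+1 m (2^-1 : R) = 2^-1.
Proof.
have := binomial_cdf_symm m 2^-1.
by rewrite (_ : 1 - 2^-1 = 2^-1); [lra|field].
Qed.

Lemma binomial_cdf_ge0 n m p : 0 <= p <= 1 -> 0 <= binomial_cdf n m p.
Proof.
move=> /andP[p0 p1]; apply: sumr_ge0 => i _.
by rewrite mulrn_wge0// mulr_ge0// exprn_ge0// subr_ge0.
Qed.

(** Pascal's rule under a sum, used to split off one observation in [affinityS]. *)
Lemma sum_binSn n (g : nat -> R) :
  \sum_(k < n.+2) g k *+ 'C(n.+1, k) =
  \sum_(k < n.+1) (g k + g k.+1) *+ 'C(n, k).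
Proof.
rewrite big_ord_recl/= bin0.
under eq_bigr do rewrite binS mulrnDr.
rewrite big_split/= big_ord_recr/= bin_small// mulr0n addr0 addrA.
under [in RHS]eq_bigr do rewrite mulrnDl.
rewrite big_split/= [in RHS]big_ord_recl/= bin0; congr (_ + _ + _).
Qed.

End binomial_cdf.

(** * Comparison of binomial tails with [Phi] *)

Section normal_approximation.
Context {R : realType}.
Implicit Types (m : nat) (p l y e : R).

Lemma is_derive_Phi_affine l (x : R) :
  is_derive x 1 (fun x : R => Phi (l * (2 * x - 1)))
    (2 * l * (Num.sqrt (pi *+ 2))^-1 *
     expR (- (l ^+ 2 * (2 * x - 1) ^+ 2 / 2))).
Proof.
have dg : is_derive x 1 (fun x : R => l * (2 * x - 1)) (2 * l).
  apply: is_derive_eq; rewrite /GRing.scale/=; ring.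
apply: (is_derive_eq (is_derive1_comp (is_derive_Phi _) dg)).
by rewrite /GRing.scale/= normal_pdf01E exprMn; ring.
Qed.

Lemma onem_exprn_le m y : 0 <= y <= 1 -> (1 - y) ^+ m <= expR (- (m%:R * y)).
Proof.
move=> /andP[y0 y1]; rewrite -mulrN expRM_natl.
rewrite lerXn2r ?nnegrE ?subr_ge0 ?expR_ge0//.
exact: expR_ge1Dx.
Qed.

(** Factor by factor and after inversion, this is [1 / (1 - y) <= expR ((1 + e) * y)]. It follows
    from [1 + x <= expR x], because [(1 + e) * y <= e] gives [(1 + (1 + e) * y) * (1 - y) >= 1]. *)
Lemma onem_exprn_ge m e y : 0 <= y -> (1 + e) * y <= e -> 0 <= e ->
  expR (- (m%:R * ((1 + e) * y))) <= (1 - y) ^+ m.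
Proof.
move=> y0 ye e0; have y1 : y < 1 by nra.
rewrite -mulrN expRM_natl lerXn2r ?nnegrE ?subr_ge0 ?expR_ge0 ?(ltW y1)//.
rewrite expRN -[leRHS]invrK lef_pV2 ?posrE ?invr_gt0 ?subr_gt0 ?expR_gt0//.
apply: (le_trans _ (expR_ge1Dx _)); rewrite -div1r ler_pdivrMr ?subr_gt0//.
nra.
Qed.

Let F m : R -> R := @binomial_cdf R m.*2.+1 m.
(** This normalization gives the derivatives of [F m x] and of [K m / l * Phi (l * (2 * x - 1))] the
    same prefactor, whatever [l] is. *)
Let K m : R :=
  (m.+1 * 'C(m.*2.+1, m.+1))%:R * Num.sqrt (pi *+ 2) / (2 * 4 ^+ m).

Let K_gt0 m : 0 < K m.
Proof.
have D0 : 0 < (m.+1 * 'C(m.*2.+1, m.+1))%:R :> R.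
  by rewrite ltr0n muln_gt0/= bin_gt0; lia.
apply: divr_gt0; last by rewrite mulr_gt0 ?exprn_gt0.
by rewrite mulr_gt0// sqrtr_gt0 mulrn_wgt0// pi_gt0.
Qed.

(** By [4 * x * (1 - x) = 1 - (2 * x - 1) ^+ 2], the sign of the derivative is decided by comparing
    a Gaussian with [(1 - y) ^+ m] at [y = (2 * x - 1) ^+ 2]. *)
Let is_derive_gap m l (x : R) : 0 < l ->
  is_derive x 1 (fun x : R => F m x + K m / l * Phi (l * (2 * x - 1)))
    ((m.+1 * 'C(m.*2.+1, m.+1))%:R / 4 ^+ m *
     (expR (- (l ^+ 2 * (2 * x - 1) ^+ 2 / 2)) - (1 - (2 * x - 1) ^+ 2) ^+ m)).
Proof.
move=> l0; have dPhi := is_derive_Phi_affine l x.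
have dF : is_derive x 1 (F m) (- (m.+1 * 'C(m.*2.+1, m.+1))%:R *
    (x ^+ m * (1 - x) ^+ (m.*2.+1 - m.+1))).
  by apply: is_derive_binomial_cdf; lia.
apply: is_derive_eq; rewrite /GRing.scale/= /K.
rewrite (_ : (m.*2.+1 - m.+1 = m)%N); last by lia.
have -> : (1 - (2 * x - 1) ^+ 2) ^+ m = 4 ^+ m * (x ^+ m * (1 - x) ^+ m).
  by rewrite -!exprMn; congr (_ ^+ m); ring.
have pi0 : Num.sqrt (pi *+ 2) != 0 :> R.
  by rewrite gt_eqF// sqrtr_gt0 mulrn_wgt0// pi_gt0.
have m0 : (4 : R) ^+ m != 0 by rewrite expf_neq0.
have l0' : l != 0 by rewrite gt_eqF.
set E := expR _; field; do ?[apply/and3P; split] => //.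
Qed.

(** For [l ^+ 2 = 2 * m] the Gaussian is [expR (- (m * y))], so by [onem_exprn_le] the function of
    [is_derive_gap] is nondecreasing from 1/2 to [p]. *)
Let binomial_cdf_ge m p : (0 < m)%N -> 2^-1 <= p <= 1 ->
  2^-1 - F m p <=
  K m / Num.sqrt (m.*2)%:R * (Phi (Num.sqrt (m.*2)%:R * (2 * p - 1)) - 2^-1).
Proof.
move=> m0 /andP[p0 p1].
set l := Num.sqrt _; have l0 : 0 < l by rewrite sqrtr_gt0 ltr0n double_gt0.
have : F m 2^-1 + K m / l * Phi (l * (2 * 2^-1 - 1)) <=
       F m p + K m / l * Phi (l * (2 * p - 1)).
  apply: (ger0_is_derive_le (fun x => is_derive_gap m x l0)) => // x.
  move=> /andP[x0 x1].
  rewrite mulr_ge0// subr_ge0.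
  have -> : l ^+ 2 * (2 * x - 1) ^+ 2 / 2 = m%:R * (2 * x - 1) ^+ 2.
    by rewrite sqr_sqrtr// -mul2n natrM; field.
  apply: onem_exprn_le; rewrite sqr_ge0/= expr2.
  nra.
rewrite divff// subrr mulr0 Phi0 [F m _]binomial_cdf_half.
lra.
Qed.

(** An upper bound on [K m]. The larger [l] turns the Gaussian into [expR (- (m * ((1 + e) * y)))],
    and [onem_exprn_ge] makes the same function nonincreasing from 1/2 to [(1 + h) / 2], where [F m]
    is still nonnegative. *)
Let binomial_cdf_le m e h : (0 < m)%N -> 0 < e -> 0 <= h ->
  (1 + e) * h ^+ 2 <= e ->
  K m / Num.sqrt ((1 + e) * (m.*2)%:R) *
    (Phi (Num.sqrt ((1 + e) * (m.*2)%:R) * h) - 2^-1) <= 2^-1.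
Proof.
move=> m0 e0 h0 he.
set l := Num.sqrt _; have l0 : 0 < l.
  by rewrite sqrtr_gt0 mulr_gt0 ?ltr0n ?double_gt0// addr_gt0.
have h1 : h <= 1.
  rewrite -(@expr_le1 _ 2)// -(ler_pM2l (_ : 0 < 1 + e)) ?addr_gt0// mulr1.
  by rewrite (le_trans he)// lerDr.
pose p := (1 + h) / 2.
have : - (F m 2^-1 + K m / l * Phi (l * (2 * 2^-1 - 1))) <=
       - (F m p + K m / l * Phi (l * (2 * p - 1))).
  apply: (ger0_is_derive_le (fun x => is_deriveN (is_derive_gap m x l0))).
    by rewrite /p; lra.
  move=> x /andP[x0 x1]; rewrite -mulrN opprB mulr_ge0// subr_ge0.
  have -> : l ^+ 2 * (2 * x - 1) ^+ 2 / 2 = m%:R * ((1 + e) * (2 * x - 1) ^+ 2).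
    by rewrite sqr_sqrtr ?mulr_ge0 ?addr_ge0 ?(ltW e0)// -mul2n natrM; field.
  apply: onem_exprn_ge; rewrite ?sqr_ge0 ?(ltW e0)//.
  apply: le_trans he; rewrite ler_wpM2l ?addr_ge0 ?(ltW e0)//.
  rewrite lerXn2r ?nnegrE//; rewrite /p in x1;lra.
rewrite divff// subrr mulr0 Phi0 [F m 2^-1]binomial_cdf_half.
have -> : 2 * p - 1 = h by rewrite /p; field.
have : 0 <= F m p by apply: binomial_cdf_ge0; rewrite /p; lra.
lra.
Qed.

(* For fixed e and h, the second factor on the left tends to 1/2 as m grows. *)
Lemma binomial_cdf_normal m p e h : (0 < m)%N -> 2^-1 <= p <= 1 ->
  0 < e -> 0 <= h -> (1 + e) * h ^+ 2 <= e ->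
  (2^-1 - binomial_cdf m.*2.+1 m p) *
    (Phi (Num.sqrt ((1 + e) * (m.*2)%:R) * h) - 2^-1) <=
  Num.sqrt (1 + e) / 2 * (Phi (Num.sqrt (m.*2)%:R * (2 * p - 1)) - 2^-1).
Proof.
move=> m0 p01 e0 h0 he.
have := binomial_cdf_ge m0 p01; have := binomial_cdf_le m0 e0 h0 he.
rewrite sqrtrM ?addr_ge0 ?(ltW e0)//.
set l := Num.sqrt (_.*2)%:R; set t := Num.sqrt (1 + e).
have l0 : 0 < l by rewrite sqrtr_gt0 ltr0n double_gt0.
have t0 : 0 < t by rewrite sqrtr_gt0 addr_gt0.
set A := Phi (t * l * h) - _; set B := Phi (l * _) - _ => hA hB.
have A0 : 0 <= A.
  by rewrite subr_ge0 -Phi0 Phi_ndecr// !mulr_ge0// ltW.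
have B0 : 0 <= B.
  rewrite subr_ge0 -Phi0 Phi_ndecr//.
  by case/andP: p01 => p0 _; rewrite mulr_ge0 ?(ltW l0)//; lra.
(* [K m] is eliminated here: [hB] multiplied by [A] contains the product that [hA] bounds by 1/2. *)
apply: le_trans (ler_wpM2r A0 hB) _.
rewrite [leLHS](_ : _ = t * B * (K m / (t * l) * A)).
  rewrite [leRHS](_ : _ = t * B * 2^-1); last by ring.
  by rewrite ler_wpM2l// mulr_ge0// ltW.
by field; rewrite !gt_eqF.
Qed.

End normal_approximation.

(** * Affinity of two product laws *)

(* The total mass of the minimum of u P_(1-p)^n and v P_p^n, i.e. the least
   weighted sum of the two errors of a test between these laws, where k counts
   the successes. *)
Definition affinity (R : realType) (n : nat) (p u v : R) : R :=
  \sum_(k < n.+1) Num.min (u * ((1 - p) ^+ k * p ^+ (n - k)))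
                          (v * (p ^+ k * (1 - p) ^+ (n - k))) *+ 'C(n, k).

Section affinity.
Context {R : realType}.
Implicit Types (n m k : nat) (p u v : R).

Lemma affinity0 p u v : affinity 0 p u v = Num.min u v.
Proof. by rewrite /affinity big_ord1 !expr0 !mulr1. Qed.

(** Conditioning on one observation: its likelihoods under the two laws are absorbed into the
    weights, success first and failure second. *)
Lemma affinityS n p u v : affinity n.+1 p u v =
  affinity n p (u * (1 - p)) (v * p) + affinity n p (u * p) (v * (1 - p)).
Proof.
pose g k := Num.min (u * ((1 - p) ^+ k * p ^+ (n.+1 - k)))
                    (v * (p ^+ k * (1 - p) ^+ (n.+1 - k))).
rewrite /affinity (sum_binSn n g) -big_split/=; apply: eq_bigr => k _.
rewrite -mulrnDl addrC /g subSS (subSn (leq_ord k)) !exprS.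
by congr ((Num.min _ _ + Num.min _ _) *+ _); ring.
Qed.

(** A sum of minima is at most the minimum of the sums: one more observation can only help the
    test. *)
Lemma affinityS_le n p u v : affinity n.+1 p u v <= affinity n p u v.
Proof.
have ge_minl (x y : R) : Num.min x y <= x by rewrite ge_min lexx.
have ge_minr (x y : R) : Num.min x y <= y by rewrite ge_min lexx orbT.
rewrite affinityS -big_split/=; apply: ler_sum => k _.
rewrite -mulrnDl lerMn2r; apply/orP; right.
rewrite le_min; apply/andP; split.
  apply: le_trans (lerD (ge_minl _ _) (ge_minl _ _)) _.
  by rewrite le_eqVlt; apply/orP; left; apply/eqP; ring.
apply: le_trans (lerD (ge_minr _ _) (ge_minr _ _)) _.
by rewrite le_eqVlt; apply/orP; left; apply/eqP; ring.
Qed.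

Lemma affinity_odd m p : 2^-1 <= p <= 1 ->
  affinity m.*2.+1 p 1 1 = 2 * binomial_cdf m.*2.+1 m p.
Proof.
move=> /andP[p0 p1]; rewrite /affinity.
have q0 : 0 <= 1 - p by rewrite subr_ge0.
have qp : 1 - p <= p by lra.
have g k : (k <= m)%N -> Num.min (1 * ((1 - p) ^+ k * p ^+ (m.*2.+1 - k)))
    (1 * (p ^+ k * (1 - p) ^+ (m.*2.+1 - k))) =
    p ^+ k * (1 - p) ^+ (m.*2.+1 - k).
  move=> km; rewrite !mul1r; apply/min_idPr.
  (* Both sides share the factor [p ^+ k * (1 - p) ^+ k]; what remains compares the powers of
     [1 - p] and [p] of exponent [m.*2.+1 - k.*2]. *)
  rewrite (_ : (m.*2.+1 - k = k + (m.*2.+1 - k.*2))%N); last by lia.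
  rewrite !exprD mulrCA [leRHS]mulrA ![in leLHS]mulrA.
  rewrite ler_wpM2l ?mulr_ge0 ?exprn_ge0//.
    by lra.
  by rewrite lerXn2r// nnegrE; lra.
rewrite (_ : m.*2.+2 = m.+1 + m.+1)%N; last by lia.
rewrite big_split_ord/= mulr_natl mulr2n; congr (_ + _).
  by apply: eq_bigr => k _; rewrite g// -ltnS.
rewrite (reindex_inj rev_ord_inj)/=; apply: eq_bigr => k _.
have km : (k <= m)%N by rewrite -ltnS.
rewrite minC -(g k km) -bin_sub; last by lia.
rewrite (_ : (m.+1 + (m.+1 - k.+1) = m.*2.+1 - k)%N); last by lia.
rewrite (_ : (m.*2.+1 - (m.*2.+1 - k) = k)%N); last by lia.
by congr (Num.min _ _ *+ _); rewrite !mul1r mulrC.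
Qed.

End affinity.

(** * Two-point laws and the testing inequality *)

Section two_point_law.
Context {R : realType}.
Implicit Types (a p : R).

Definition pm (a : R) (b : bool) : R := if b then a else - a.

Lemma measurable_pm a : measurable_fun [set: bool] (pm a).
Proof. by []. Qed.

HB.instance Definition _ a :=
  isMeasurableFun.Build _ _ _ _ (pm a) (measurable_pm a).

Definition two_point_law a p : probability R R :=
  distribution (bernoulli_prob p) (pm a).

Lemma ge0_integral_two_point_law a p (f : R -> \bar R) : 0 <= p <= 1 ->
  measurable_fun setT f -> (forall x, (0 <= f x)%E) ->
  (\int[two_point_law a p]_x f x = p%:E * f a + (1 - p)%:E * f (- a)%R)%E.
Proof.
move=> p01 mf f0.
by rewrite ge0_integral_distribution// integral_bernoulli_prob/=.
Qed.

Lemma mean_two_point_law a p : 0 <= p <= 1 -> 0 <= a ->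
  (\int[two_point_law a p]_x x%:E = ((2 * p - 1) * a)%:E)%E.
Proof.
(* The integral formula is for nonnegative functions, hence the split into positive and negative
   parts. *)
move=> p01 a0; rewrite integralE !ge0_integral_two_point_law//; last 2 first.
- by apply: measurable_funeneg; exact: EFin_measurable.
- by apply: measurable_funepos; exact: EFin_measurable.
rewrite !funeposE !funenegE -!EFinN -!EFin_max -!EFinM -!EFinD.
have Na0 : - a <= 0 by rewrite oppr_le0.
rewrite opprK (max_idPl a0) (max_idPr Na0).
congr EFin; ring.
Qed.

(** The distance to the mean is at most [a + |2 * p - 1| * a] at both atoms, so the moment bound
    holds pointwise before averaging. *)
Lemma two_point_law_in_class (sigma alpha a p : R) : 0 <= p <= 1 -> 0 <= a ->
  0 <= alpha -> a * (1 + `|2 * p - 1|) <= sigma ->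
  mean_moment_class sigma alpha ((2 * p - 1) * a) (two_point_law a p).
Proof.
move=> p01 a0 alpha0 asigma; split; first exact: mean_two_point_law.
have [p0 p1] := andP p01.
rewrite (@ge0_integral_two_point_law a p
  (fun x => (`|x - (2 * p - 1) * a| `^ alpha)%:E))//; last first.
  apply/measurable_EFinP.
  apply: (@measurableT_comp _ _ _ _ _ _ (@powR R ^~ alpha)) => //.
  apply: measurableT_comp => //; exact: measurable_funB.
have moment_le y : `|y| <= a ->
  `|y - (2 * p - 1) * a| `^ alpha <= sigma `^ alpha.
  move=> ya; have h : `|y - (2 * p - 1) * a| <= sigma.
    apply: le_trans (ler_normB _ _) _; rewrite normrM (ger0_norm a0).
    by apply: le_trans asigma; rewrite mulrDr mulr1 lerD// mulrC.
  by rewrite ge0_ler_powR// nnegrE (le_trans _ h).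
rewrite -!EFinM -EFinD lee_fin.
have /(ler_wpM2l p0) h1 : `|a - (2 * p - 1) * a| `^ alpha <= sigma `^ alpha.
  by apply: moment_le; rewrite ger0_norm.
have /(ler_wpM2l (_ : 0 <= 1 - p)) h2 :
  `|- a - (2 * p - 1) * a| `^ alpha <= sigma `^ alpha.
  by apply: moment_le; rewrite normrN ger0_norm.
apply: le_trans (lerD h1 (h2 _)) _; first by rewrite subr_ge0.
by rewrite -mulrDl subrKC mul1r.
Qed.

Lemma xsection_tcons n (A : set (n.+1.-tuple R)) (x : R) :
  xsection (@tcons _ R n @^-1` A) x = [set t | A (tcons (x, t))].
Proof. by apply/seteqP; split => t; rewrite /xsection/= inE. Qed.

Lemma measurable_preimage_tcons n (A : set (n.+1.-tuple R)) :
  measurable A -> measurable (@tcons _ R n @^-1` A).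
Proof. by move=> mA; rewrite -[_ @^-1` _]setTI; exact: measurable_tcons. Qed.

Lemma iid_two_point_lawS a p n (A : set (n.+1.-tuple R)) : 0 <= p <= 1 ->
  measurable A ->
  (iid_law (two_point_law a p) n.+1 A =
   p%:E * iid_law (two_point_law a p) n [set t | A (tcons (a, t))] +
   (1 - p)%:E * iid_law (two_point_law a p) n
     [set t | A (tcons ((- a)%R, t))])%E.
Proof.
move=> p01 mA.
have mB := measurable_preimage_tcons mA.
(* The product measure is by definition the integral of the measures of the sections. *)
transitivity (\int[two_point_law a p]_x
    iid_law (two_point_law a p) n (xsection (@tcons _ R n @^-1` A) x))%E => //.
rewrite ge0_integral_two_point_law//; last exact: measurable_fun_xsection.
by rewrite !xsection_tcons.
Qed.

(** The lower bound of Neyman-Pearson, by induction on the first observation; arbitrary weights let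
    the induction hypothesis absorb its likelihoods. With no observation left, the test pays [u] or
    [v]. *)
Lemma affinity_le_test_error a p n (A : set (n.-tuple R)) u v :
  0 <= p <= 1 -> 0 <= u -> 0 <= v -> measurable A ->
  ((affinity n p u v)%:E <= u%:E * iid_law (two_point_law a (1 - p)) n A +
                         v%:E * iid_law (two_point_law a p) n (~` A))%E.
Proof.
move=> p01 u0 v0 mA; have [p0 p1] := andP p01.
have q01 : 0 <= 1 - p <= 1 by rewrite subr_ge0 p1 gerBl.
elim: n => [|n IHn] in A u v u0 v0 mA *.
  rewrite affinity0 /= !diracE in_setC; case: (_ \in A) => /=.
    by rewrite mule1 mule0 adde0 lee_fin ge_min lexx.
  by rewrite mule1 mule0 add0e lee_fin ge_min lexx orbT.
have mS (x : R) : measurable [set t | A (tcons (x, t))].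
  rewrite -xsection_tcons; apply: measurable_xsection;
  exact: measurable_preimage_tcons.
rewrite !iid_two_point_lawS//; last exact: measurableC.
rewrite affinityS EFinD.
have q0 : 0 <= 1 - p by rewrite subr_ge0.
apply: le_trans (leeD (IHn _ _ _ _ _ (mS a)) (IHn _ _ _ _ _ (mS (- a)))) _;
  rewrite ?mulr_ge0//.
rewrite subKr; set q := two_point_law a p; set q' := two_point_law a (1 - p).
(* Replacing the finite probabilities by reals leaves an identity for [ring]. *)
have fin (P : probability R R) (B : set (n.-tuple R)) :
  measurable B -> exists x : R, iid_law P n B = x%:E.
  by move=> mB; exists (fine (iid_law P n B)); rewrite fineK// fin_num_measure.
have [x1 ->] := fin q' _ (mS a); have [x2 ->] := fin q' _ (mS (- a)).
have [y1 ->] := fin q _ (measurableC (mS a)).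
have [y2 ->] := fin q _ (measurableC (mS (- a))).
by rewrite -!EFinM -!EFinD lee_fin le_eqVlt; apply/orP; left; apply/eqP; ring.
Qed.

End two_point_law.

(** * From the test to the asymptotic bound *)

Section lower_bound.
Context {R : realType}.

(** The means are [(2 * p - 1) * a] and its opposite, both further than [Delta] from 0, so an
    estimate of the wrong sign misses by more than [Delta]. The condition [a * (2 * p) <= sigma]
    puts both laws in the class. *)
Lemma worst_case_level_ge (sigma alpha a p Delta : R) (n m : nat)
    (est : n.-tuple R -> R) :
  0 <= alpha -> 2^-1 <= p <= 1 -> 0 <= a -> a * (2 * p) <= sigma ->
  Delta < (2 * p - 1) * a -> (n <= m.*2.+1)%N ->
  measurable_fun [set: n.-tuple R] est ->
  ((binomial_cdf m.*2.+1 m p)%:E <= worst_case_level sigma alpha est Delta)%E.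
Proof.
move=> alpha0 /andP[p_ge p1] a0 asigma Da nm mest.
have p01 : 0 <= p <= 1 by lra.
have q01 : 0 <= 1 - p <= 1 by lra.
set W := worst_case_level _ _ _ _.
pose A := [set x | 0 < est x].
have mA : measurable A.
  rewrite (_ : A = est @^-1` `]0, +oo[); last first.
    by apply/seteqP; split => x /=; rewrite in_itv/= andbT.
  by rewrite -[_ @^-1` _]setTI; apply: mest.
have A_le : (iid_law (two_point_law a (1 - p)) n A <= W)%E.
  rewrite /W /worst_case_level le_max; apply/orP; left.
  pose mu := (2 * (1 - p) - 1) * a.
  apply: (@le_trans _ _
      (iid_law (two_point_law a (1 - p)) n [set x | est x > mu + Delta])).
    rewrite le_measure ?inE//.
      rewrite (_ : [set x | _] = est @^-1` `]mu + Delta, +oo[); last first.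
        by apply/seteqP; split => x /=; rewrite in_itv/= andbT.
      by rewrite -[_ @^-1` _]setTI; apply: mest.
    by move=> x; apply: le_lt_trans; rewrite /mu; lra.
  apply: ereal_sup_ubound; exists mu; exists (two_point_law a (1 - p)) => //.
  apply: two_point_law_in_class => //.
  by rewrite ler0_norm; lra.
have AC_le : (iid_law (two_point_law a p) n (~` A) <= W)%E.
  rewrite /W /worst_case_level le_max; apply/orP; right.
  pose mu := (2 * p - 1) * a.
  apply: (@le_trans _ _
      (iid_law (two_point_law a p) n [set x | est x < mu - Delta])).
    rewrite le_measure ?inE//.
    - exact: measurableC.
    - rewrite (_ : [set x | _] = est @^-1` `]-oo, mu - Delta[); last first.
        by apply/seteqP; split => x /=; rewrite in_itv/=.
      by rewrite -[_ @^-1` _]setTI; apply: mest.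
    by move=> x /negP; rewrite -leNgt => /le_lt_trans; apply; rewrite subr_gt0.
  apply: ereal_sup_ubound; exists mu; exists (two_point_law a p) => //.
  apply: two_point_law_in_class => //.
  by rewrite ger0_norm; lra.
(* Extra observations make the sample size odd, so that a majority vote has no ties. *)
have aff : affinity m.*2.+1 p 1 1 <= affinity n p 1 1.
  rewrite -(subnK nm); elim: (_ - _)%N => [//|k]; rewrite addSn.
  exact/le_trans/affinityS_le.
have := affinity_le_test_error a p01 ler01 ler01 mA; rewrite !mul1e => test.
have : ((2 * binomial_cdf m.*2.+1 m p)%:E <= W + W)%E.
  rewrite -affinity_odd ?p_ge//; apply: (@le_trans _ _ (affinity n p 1 1)%:E).
    by rewrite lee_fin.
  exact: le_trans test (leeD A_le AC_le).
case: W {A_le AC_le} => [w| |]; [|by move=> _; rewrite leey|by []].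
by rewrite -EFinD !lee_fin; lra.
Qed.

Lemma limn_einf_ge (u : (\bar R)^nat) (c : \bar R) :
  (\forall n \near \oo, (c <= u n)%E) -> (c <= limn_einf u)%E.
Proof.
move=> [N _ uN]; rewrite limn_einf_lim.
apply: lime_ge; first exact: is_cvg_einfs.
exists N => // n /= Nn; apply: le_ereal_inf_tmp => _ [k /= nk <-].
by apply: uN; exact: leq_trans Nn nk.
Qed.

(** Here [2 * p - 1 = c1 / (Num.sqrt n - c1)]; the margin between [c1] and [c2] absorbs the shift by
    [c1] in the denominator. *)
Lemma near_binomial_cdf_gt (c1 c2 b : R) : 0 < c1 -> c1 < c2 ->
  0 < b -> Phi c2 < 1 - b ->
  \forall n \near \oo, let p := (1 + c1 / (Num.sqrt n%:R - c1)) / 2 in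
    [/\ c1 < Num.sqrt n%:R, p <= 1 & b < binomial_cdf n./2.*2.+1 n./2 p].
Proof.
move=> c1_gt0 c12 b_gt0 c2b.
have c2_gt0 : 0 < c2 by exact: lt_trans c12.
pose A := Phi c2 - 2^-1; pose B := 2^-1 - b.
have A0 : 0 < A by rewrite subr_gt0 -Phi0; exact: Phi_incr.
have AB : A < B by rewrite /A /B; lra.
have B0 : 0 < B by exact: lt_trans AB.
(* The square root places [t] strictly between 1 and [B / A]: [t > 1] leaves room for
   [e = t ^+ 2 - 1], and [t * A < B] makes the threshold for [PhiX] less than 1. The choice of [h]
   attains equality in the condition of [binomial_cdf_normal]. *)
pose t := Num.sqrt (B / A).
have BA1 : 1 < B / A by rewrite ltr_pdivlMr ?mul1r.
have t2 : t ^+ 2 = B / A by rewrite sqr_sqrtr// ltW// (lt_trans ltr01).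
have t1 : 1 < t by rewrite -sqrtr1 ltr_sqrt// (lt_trans ltr01).
have tA : t * A < B.
  have -> : B = t * (t * A) by rewrite mulrA -expr2 t2 divfK// gt_eqF.
  by rewrite ltr_pMl// mulr_gt0// (lt_trans ltr01).
pose e := B / A - 1; have e0 : 0 < e by rewrite subr_gt0.
pose h := Num.sqrt (e / (1 + e)).
have e1_gt0 : 0 < 1 + e by rewrite addr_gt0.
have h2 : (1 + e) * h ^+ 2 = e.
  by rewrite sqr_sqrtr ?divr_ge0 ?ltW// mulrC divfK// gt_eqF.
have h0 : 0 <= h by rewrite sqrtr_ge0.
have [X [_ PhiX]] : \forall x \near +oo, 2^-1 + t * A / (2 * B) < Phi x.
  apply: (cvgr_gt 1 cvg_Phiy).
  have : t * A / (2 * B) < 2^-1.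
    by rewrite ltr_pdivrMr ?mulr_gt0// mulKf.
  lra.
near=> n.
have mn : (n./2.*2 <= n)%N by rewrite -[leqRHS]odd_double_half leq_addl.
have nm : (n <= n./2.*2.+1)%N.
  by rewrite -[leqLHS]odd_double_half -add1n leq_add2r leq_b1.
set r := Num.sqrt _; set m := n./2; set p := (1 + _) / 2 => /=.
have n_ge (K : R) : K ^+ 2 <= n%:R -> K <= r.
  by move=> Kn; rewrite (le_trans (ler_norm _))// -sqrtr_sqr ler_wsqrtr.
(* These bounds give in turn [p <= 1], [r * (c1 / (r - c1)) <= c2], and an argument of [Phi] beyond
   [X]. *)
have rc1 : 2 * c1 <= r.
  by apply: n_ge; near: n; exact: nbhs_infty_ger.
have rc2 : c1 * c2 / (c2 - c1) <= r.
  by apply: n_ge; near: n; exact: nbhs_infty_ger.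
have nX : (X ^+ 2 + 1) / e + 1 <= n%:R.
  by near: n; exact: nbhs_infty_ger.
have m0 : (0 < m)%N.
  by rewrite /m half_gt0; near: n; exists 2%N.
have c1r : c1 < r by lra.
have s1 : c1 / (r - c1) <= 1 by rewrite ler_pdivrMr ?subr_gt0//; lra.
have s0 : 0 <= c1 / (r - c1) by rewrite divr_ge0 ?subr_ge0// ltW.
have p01 : 2^-1 <= p <= 1 by rewrite /p; apply/andP; split; lra.
split => //; first by case/andP: p01.
have h2e : (1 + e) * h ^+ 2 <= e by rewrite h2.
have := binomial_cdf_normal m0 p01 e0 h0 h2e.
rewrite (_ : 2 * p - 1 = c1 / (r - c1)); last by rewrite /p; lra.
have : Phi (Num.sqrt m.*2%:R * (c1 / (r - c1))) <= Phi c2.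
  apply: Phi_ndecr; apply: (@le_trans _ _ (r * (c1 / (r - c1)))).
    by rewrite ler_wpM2r// ler_wsqrtr// ler_nat.
  rewrite mulrA ler_pdivrMr ?subr_gt0//.
  move: rc2; rewrite ler_pdivrMr ?subr_gt0//; lra.
have : 2^-1 + t * A / (2 * B) < Phi (Num.sqrt ((1 + e) * m.*2%:R) * h).
  apply: PhiX; rewrite -sqrtrM ?mulr_ge0 ?(ltW e1_gt0)//.
  rewrite (_ : _ * _ * _ = e * m.*2%:R); last by field; rewrite gt_eqF.
  rewrite (le_lt_trans (ler_norm _))// -sqrtr_sqr ltr_sqrt; last first.
    by rewrite mulr_gt0// ltr0n double_gt0.
  have : (n%:R : R) <= m.*2%:R + 1 by rewrite natr1 ler_nat.
  move: nX; rewrite -lerBrDr ler_pdivrMr//.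
  nra.
rewrite (_ : 1 + e = t ^+ 2); last by rewrite t2 /e subrKC.
rewrite sqrtr_sqr ger0_norm ?sqrtr_ge0//.
set P1 := Phi _; set P2 := Phi _; set F := binomial_cdf _ _ _ => hP1 hP2 hF.
(* If [F <= b], then [1/2 - F >= B], and the left side of [hF] exceeds [t / 2 * A], which bounds its
   right side. *)
rewrite ltNge; apply/negP => Fb.
have BP : B * (t * A / (2 * B)) < B * (P1 - 2^-1) by rewrite ltr_pM2l//; lra.
have BF : B * (P1 - 2^-1) <= (2^-1 - F) * (P1 - 2^-1).
  rewrite ler_wpM2r ?subr_ge0 ?lerD2l ?lerN2// ltW//.
  apply: le_lt_trans hP1; rewrite lerDl divr_ge0 ?mulr_ge0 ?ltW//.
  exact: lt_trans t1.
have tP : t / 2 * (P2 - 2^-1) <= t / 2 * A.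
  by rewrite ler_wpM2l ?divr_ge0 ?sqrtr_ge0// lerD2r.
have tAB : B * (t * A / (2 * B)) = t / 2 * A by field; rewrite gt_eqF.
lra.
Unshelve. all: by end_near. Qed.

End lower_bound.

Theorem proposition6 (R : realType) (sigma alpha beta : R)
  (Delta : nat -> R) (est : forall n : nat, n.-tuple R -> R)
  (sigma_gt0 : 0 < sigma) (alpha_ge2 : 2 <= alpha)
  (beta_gt0 : 0 < beta) (beta_lt_half : beta < 2^-1)
  (Delta_gt0 : forall n, (0 < n)%N -> 0 < Delta n)
  (measurable_est : forall n, (0 < n)%N ->
     measurable_fun [set: n.-tuple R] (est n))
  (est_level : forall n, (0 < n)%N ->
     (worst_case_level sigma alpha (est n) (Delta n) <= beta%:E)%E) :
  (limn_einf (fun n => (Num.sqrt n%:R * Delta n / sigma)%:E)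
     >= (Phi_inv (1 - beta))%:E)%E.
Proof.
set z : R := Phi_inv _.
have Phiz : Phi z = 1 - beta by apply: Phi_invK; lra.
have z0 : 0 < z.
  by rewrite ltNge; apply/negP => /Phi_ndecr; rewrite Phiz Phi0; lra.
(* In the maximum below, [z / 2] keeps [c] positive when [eps] is large. *)
suff main c : 0 < c < z ->
    (c%:E <= limn_einf (fun n => (Num.sqrt n%:R * Delta n / sigma)%:E))%E.
  apply/lee_subgt0Pr => eps eps0; pose c := Num.max (z - eps) (z / 2).
  apply: le_trans (main c _).
    by rewrite -EFinB lee_fin le_max lexx.
  rewrite lt_max gt_max; lra.
move=> /andP[c0 cz]; apply: limn_einf_ge.
(* In [c < c1 < c2 < z], the first gap makes the means exceed [Delta n] strictly, the second serves
   the binomial estimate, and the third gives [Phi c2 < 1 - beta]. *)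
pose c1 := (c + z) / 2; pose c2 := (c1 + z) / 2.
have c1_gt0 : 0 < c1 by rewrite /c1; lra.
have c12 : c1 < c2 by rewrite /c2 /c1; lra.
have c2z : Phi c2 < 1 - beta by rewrite -Phiz Phi_incr// /c2 /c1; lra.
near=> n.
have n0 : (0 < n)%N by near: n; exists 1%N.
have [c1r p1 beta_lt] : [/\ c1 < Num.sqrt n%:R,
    (1 + c1 / (Num.sqrt n%:R - c1)) / 2 <= 1 &
    beta < binomial_cdf n./2.*2.+1 n./2 ((1 + c1 / (Num.sqrt n%:R - c1)) / 2)].
  by near: n; exact: near_binomial_cdf_gt c2z.
set r : R := Num.sqrt _ in c1r p1 beta_lt *.
have r0 : 0 < r := lt_trans c1_gt0 c1r.
rewrite lee_fin leNgt; apply/negP => Dc.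
(* With [d = c1 * sigma / r], these are [a = sigma - d] and [p = (1 + d / a) / 2], so that
   [a * (2 * p) = sigma]. *)
pose a := sigma * (r - c1) / r; pose p := (1 + c1 / (r - c1)) / 2.
have rc0 : 0 < r - c1 by rewrite subr_gt0.
have s0 : 0 <= c1 / (r - c1) by rewrite divr_ge0// ltW.
have mean_pa : (2 * p - 1) * a = c1 * sigma / r.
  by rewrite /p /a; field; rewrite !gt_eqF.
have : ((binomial_cdf n./2.*2.+1 n./2 p)%:E <= beta%:E)%E.
  apply: le_trans (est_level _ n0).
  apply: (@worst_case_level_ge _ sigma alpha a) => //.
  - by lra.
  - by apply/andP; split => //; rewrite /p; lra.
  - by rewrite /a divr_ge0 ?mulr_ge0// ltW.
  - rewrite (_ : a * (2 * p) = sigma)//.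
    by rewrite /p /a; field; rewrite !gt_eqF.
  - rewrite mean_pa ltr_pdivlMr//; apply: (@lt_trans _ _ (c * sigma)).
      by move: Dc; rewrite ltr_pdivrMr// mulrC.
    by rewrite ltr_pM2r// /c1; lra.
  - by rewrite -[leqLHS]odd_double_half -add1n leq_add2r leq_b1.
  - exact: measurable_est.
by rewrite lee_fin leNgt beta_lt.
Unshelve. all: by end_near. Qed.
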